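(* Let $\Omega\subset\mathbb{R}^N$ be a bounded open set, $r>0$, $L>0$ and $C\subset\mathbb{R}^{N-1}$ a finite closed cone with vertex at $0$. Then there exist $r'>0$, $L'>0$ and $M_0\in\mathbb{N}$, with $r',L'$ depending only on $r,L,C$ and $M_0$ depending only on $r,L,C$ and the diameter of $\Omega$, such that every $K\in\mathcal{G}(r,L,C)$ belongs to $\mathcal{FR}(r',L',M_0)$.
   Context: Let $\pi=\{y\in\mathbb{R}^N:y_N=0\}$ (identified with $\mathbb{R}^{N-1}$) and $\pi^+=\{y\in\pi:y_{N-1}\ge0\}$. A finite closed cone with vertex $x$ is a set $x+(\overline{B_1}\cap\{\lambda y:y\in\overline{B_2},\lambda\ge0\})$ with $B_1,B_2$ open balls, $B_1$ centred at $0$, $0\notin B_2$; cones are congruent if related by a rigid motion. A nonempty compact $K\subset\overline\Omega$ is a Lipschitz hypersurface with constants $r,L$ if for each $x\in K$ there is $\Phi_x:B_r(x)\to\mathbb{R}^N$ with $L^{-1}|z_1-z_2|\le|\Phi_x(z_1)-\Phi_x(z_2)|\le L|z_1-z_2|$, $\Phi_x(x)=0$, $\Phi_x(K\cap B_r(x))\subset\pi$; $x$ is interior if $B_\delta(0)\cap\pi\subset\Phi_x(K\cap B_r(x))$ for some $\delta>0$; $\mathrm{bdry}(K)$ = non-interior points. $K\in\mathcal{G}(r,L,C)$ if it is such a Lipschitz hypersurface and for every $x\in K$ and $y\in B_{r/2}(x)\cap K$ there is a finite closed cone $C_y\subset\pi$ congruent to $C$ with $\Phi_x(y)\in C_y\subset\Phi_x(\overline{B_r(x)}\cap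 K)$. $K\in\mathcal{MR}(r,L)$ if it is a Lipschitz hypersurface with constants $r,L$ and $\Phi_x(K\cap B_r(x))=\Phi_x(B_r(x))\cap\pi^+$ for every $x\in\mathrm{bdry}(K)$. $K\in\mathcal{FR}(r,L,M_0)$ if $K$ is a Lipschitz hypersurface with constants $r,L$ and $K=\bigcup_{j=1}^JH^j$ with $H^j\in\mathcal{MR}(r,L)$ and $1\le J\le M_0$. *)

(* Defs.v *)
From HB Require Import structures.
From mathcomp Require Import all_boot all_order all_algebra.
From mathcomp Require Import all_classical all_reals all_analysis.
Unset Printing Implicit Defensive.
Import Order.TTheory GRing.Theory Num.Theory.
Import numFieldNormedType.Exports.
Local Open Scope ring_scope.
Local Open Scope classical_set_scope.

Section Defs.
Variable R : realType.

Definition enorm {m} (v : 'rV[R]_m) : R := Num.sqrt (\sum_i v 0 i ^+ 2).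
Definition edist {m} (a b : 'rV[R]_m) : R := enorm (a - b).
Definition eball {m} (x : 'rV[R]_m) (r : R) : set 'rV[R]_m := [set z | edist z x < r].
Definition ecball {m} (x : 'rV[R]_m) (r : R) : set 'rV[R]_m := [set z | edist z x <= r].

Definition ebounded {m} (A : set 'rV[R]_m) := exists M : R, forall a, A a -> enorm a <= M.
Definition diam_eq {m} (A : set 'rV[R]_m) (D : R) :=
  (forall a b, A a -> A b -> edist a b <= D) /\
  (forall e : R, 0 < e -> exists a b, A a /\ A b /\ D - e < edist a b).

Definition rigid {m} (g : 'rV[R]_m -> 'rV[R]_m) := forall a b, edist (g a) (g b) = edist a b.
Definition congruent {m} (A B : set 'rV[R]_m) := exists g, rigid g /\ B = g @` A.

(* finite closed cone with vertex x:
   x + (\overline{B_1} \cap {l y : y in \overline{B_2}, l >= 0}),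
   B_1 = B_rho(0), B_2 = B_s(c) open balls (rho, s > 0), 0 \notin B_2;
   the closure of B_s(c) is the closed ball. *)
Definition finite_closed_cone {m} (x : 'rV[R]_m) (S : set 'rV[R]_m) :=
  exists (rho : R) (c : 'rV[R]_m) (s : R),
    0 < rho /\ 0 < s /\ ~ eball c s 0 /\
    S = [set x + y | y in ecball 0 rho `&`
           [set v | exists l : R, exists w, 0 <= l /\ ecball c s w /\ v = l *: w]].

(* R^N with N = n.+2; pi = {y_N = 0}, pi^+ = {y in pi, y_{N-1} >= 0} (0-based indices) *)
Definition piN n : set 'rV[R]_(n.+2) := [set y | y 0 ord_max = 0].
Definition piplus n : set 'rV[R]_(n.+2) := [set y | piN n y /\ 0 <= y 0 (inord n)].
Definition emb n (y : 'rV[R]_(n.+1)) : 'rV[R]_(n.+2) :=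
  \row_(i < n.+2) (if (i < n.+1)%N then y 0 (inord i) else 0).

Definition lip_charts n (Omega K : set 'rV[R]_(n.+2)) (r L : R)
    (Phi : 'rV[R]_(n.+2) -> 'rV[R]_(n.+2) -> 'rV[R]_(n.+2)) :=
  K !=set0 /\ compact K /\ K `<=` closure Omega /\
  forall x, K x ->
    (forall z1 z2, ecball x r z1 -> ecball x r z2 ->
       L^-1 * edist z1 z2 <= edist (Phi x z1) (Phi x z2) /\
       edist (Phi x z1) (Phi x z2) <= L * edist z1 z2) /\
    Phi x x = 0 /\
    Phi x @` (K `&` eball x r) `<=` piN n.

Definition interior_pt n (K : set 'rV[R]_(n.+2)) (r : R) Phi (x : 'rV[R]_(n.+2)) :=
  exists d : R, 0 < d /\ eball 0 d `&` piN n `<=` Phi x @` (K `&` eball x r).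

Definition classG n (Omega K : set 'rV[R]_(n.+2)) (r L : R) (C : set 'rV[R]_(n.+1)) :=
  exists Phi, lip_charts n Omega K r L Phi /\
    forall x y, K x -> K y -> eball x (r / 2) y ->
      exists D : set 'rV[R]_(n.+1), congruent C D /\
        (emb n @` D) (Phi x y) /\
        emb n @` D `<=` Phi x @` (ecball x r `&` K).

Definition classMR n (Omega H : set 'rV[R]_(n.+2)) (r L : R) :=
  exists Phi, lip_charts n Omega H r L Phi /\
    forall x, H x -> ~ interior_pt n H r Phi x ->
      Phi x @` (H `&` eball x r) = Phi x @` eball x r `&` piplus n.

Definition classFR n (Omega K : set 'rV[R]_(n.+2)) (r L : R) (M0 : nat) :=
  (exists Phi, lip_charts n Omega K r L Phi) /\
  exists (J : nat) (H : nat -> set 'rV[R]_(n.+2)),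
    (1 <= J <= M0)%N /\
    K = \bigcup_(j in [set j | (j < J)%N]) H j /\
    forall j, (j < J)%N -> classMR n Omega (H j) r L.

End Defs.

Arguments enorm {R m}. Arguments edist {R m}. Arguments eball {R m}. Arguments ecball {R m}.
Arguments ebounded {R m}. Arguments diam_eq {R m}. Arguments rigid {R m}.
Arguments congruent {R m}. Arguments finite_closed_cone {R m}.
Arguments piN {R}. Arguments piplus {R}. Arguments emb {R}.
Arguments lip_charts {R} n. Arguments interior_pt {R} n. Arguments classG {R} n.
Arguments classMR {R} n. Arguments classFR {R} n.

(* Main.v *)
From Pilot Require Import Defs.
From HB Require Import structures.
From mathcomp Require Import all_boot all_order all_algebra.
From mathcomp Require Import all_classical all_reals all_analysis.
From mathcomp Require Import ring lra.
Import Order.TTheory GRing.Theory Num.Theory.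
Import numFieldNormedType.Exports.
(* mathcomp-analysis shadows [edist]. *)
Import Pilot.Defs.
Local Open Scope ring_scope.
Local Open Scope classical_set_scope.

(** A congruent copy of the cone C is a convex set containing a ball of fixed
    radius.  After shrinking each copy towards the point it is meant to cover,
    so that its preimage stays well inside the chart, finitely many clusters of
    copies with nearby ball centres suffice near each point of K, and the
    closure of the union of a cluster is star-shaped with respect to a common
    ball.  Such a star-shaped set is, near each relative boundary point, a
    region below the graph of a Lipschitz function with controlled constant;
    exchanging this region with a half-space by a bi-Lipschitz involution turns
    the chart of K into a chart showing that the preimage of the star-shaped
    set is in MR.  A finite net of K, whose cardinality is controlled by the
    diameter, gives the bound on the number of pieces. *)

(** * Euclidean norm, distance and topology on row vectors *)

Section Euclidean.
Context {R : realType} {m : nat}.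
Implicit Types a b c v : 'rV[R]_m.

Definition dot a b : R := \sum_i a 0 i * b 0 i.

Lemma dotC a b : dot a b = dot b a.
Proof. by apply: eq_bigr => i _; rewrite mulrC. Qed.

Lemma dotDl a b c : dot (a + b) c = dot a c + dot b c.
Proof. by rewrite -big_split; apply: eq_bigr => i _; rewrite mxE mulrDl. Qed.

Lemma dotZl (k : R) a b : dot (k *: a) b = k * dot a b.
Proof. by rewrite mulr_sumr; apply: eq_bigr => i _; rewrite mxE mulrA. Qed.

Lemma dotNl a b : dot (- a) b = - dot a b.
Proof. by rewrite -scaleN1r dotZl mulN1r. Qed.

Lemma dotDr a b c : dot a (b + c) = dot a b + dot a c.
Proof. by rewrite dotC dotDl !(dotC a). Qed.

Lemma dotZr (k : R) a b : dot a (k *: b) = k * dot a b.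
Proof. by rewrite dotC dotZl dotC. Qed.

Lemma dotNr a b : dot a (- b) = - dot a b.
Proof. by rewrite dotC dotNl dotC. Qed.

Definition dotE := (dotDl, dotDr, dotZl, dotZr, dotNl, dotNr).

Lemma dot_delta a k : dot a (delta_mx 0 k) = a 0 k.
Proof.
rewrite /dot (bigD1 k)//= big1 ?addr0 ?mxE ?eqxx ?mulr1// => j jk.
by rewrite mxE eqxx (negbTE jk) mulr0.
Qed.

Lemma dot_ge0 a : 0 <= dot a a.
Proof. by apply: sumr_ge0 => i _; rewrite -expr2 sqr_ge0. Qed.

Lemma enorm_sqrt_dot a : enorm a = Num.sqrt (dot a a).
Proof. by congr Num.sqrt; apply: eq_bigr => i _; rewrite expr2. Qed.

Lemma enorm_ge0 a : 0 <= enorm a.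
Proof. exact: sqrtr_ge0. Qed.

Lemma sqr_enorm a : enorm a ^+ 2 = dot a a.
Proof. by rewrite enorm_sqrt_dot sqr_sqrtr// dot_ge0. Qed.

Lemma ler_coord_enorm a i : `|a 0 i| <= enorm a.
Proof.
rewrite -(@ler_pXn2r _ 2%N) ?nnegrE ?enorm_ge0// sqr_enorm real_normK ?num_real//.
rewrite /dot (bigD1 i)//= expr2 lerDl; apply: sumr_ge0 => j _.
by rewrite -expr2 sqr_ge0.
Qed.

Lemma enorm_eq0 a : enorm a = 0 -> a = 0.
Proof.
move=> a0; apply/rowP => i; rewrite mxE; apply/eqP; rewrite -normr_le0 -a0.
exact: ler_coord_enorm.
Qed.

Lemma enorm0 : enorm (0 : 'rV[R]_m) = 0.
Proof. by rewrite enorm_sqrt_dot /dot big1 ?sqrtr0// => i _; rewrite mxE mul0r. Qed.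

Lemma enormZ (k : R) a : enorm (k *: a) = `|k| * enorm a.
Proof.
by rewrite !enorm_sqrt_dot dotZl dotZr mulrA -expr2 sqrtrM ?sqr_ge0// sqrtr_sqr.
Qed.

Lemma enormN a : enorm (- a) = enorm a.
Proof. by rewrite -scaleN1r enormZ normrN normr1 mul1r. Qed.

(** Cauchy-Schwarz, from the nonnegative squared norm of [dot b b *: a - dot a b *: b]. *)
Lemma ler_norm_dot a b : `|dot a b| <= enorm a * enorm b.
Proof.
have [b0|bn0] := eqVneq (enorm b) 0.
  rewrite b0 mulr0 (enorm_eq0 _ b0) /dot big1 ?normr0// => i _.
  by rewrite mxE mulr0.
have bp : 0 < dot b b by rewrite -sqr_enorm exprn_gt0// lt_neqAle eq_sym bn0 enorm_ge0.
rewrite -(@ler_pXn2r _ 2%N) ?nnegrE ?mulr_ge0 ?enorm_ge0//.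
rewrite real_normK ?num_real// exprMn !sqr_enorm.
have := dot_ge0 (dot b b *: a - dot a b *: b).
rewrite !dotE (dotC b a).
rewrite [X in 0 <= X -> _](_ : _ = dot b b * (dot a a * dot b b - dot a b ^+ 2)).
  by rewrite pmulr_rge0// subr_ge0.
by ring.
Qed.

Lemma ler_enormD a b : enorm (a + b) <= enorm a + enorm b.
Proof.
rewrite -(@ler_pXn2r _ 2%N) ?nnegrE ?addr_ge0 ?enorm_ge0//.
have := le_trans (ler_norm _) (ler_norm_dot a b).
rewrite sqrrD !sqr_enorm !dotE (dotC b a); lra.
Qed.

Lemma edist_ge0 a b : 0 <= edist a b.
Proof. exact: enorm_ge0. Qed.

Lemma edistC a b : edist a b = edist b a.
Proof. by rewrite /edist -enormN opprB. Qed.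

Lemma edistxx a : edist a a = 0.
Proof. by rewrite /edist subrr enorm0. Qed.

Lemma edist_eq0 a b : edist a b = 0 -> a = b.
Proof. by move=> /enorm_eq0/subr0_eq. Qed.

Lemma edist_triangle c a b : edist a b <= edist a c + edist c b.
Proof. by rewrite /edist -{1}(subrKA c); exact: ler_enormD. Qed.

(** The crude factor [m + 1], instead of the square root of [m], is never zero and can be divided
    by. *)
Lemma ler_enorm_coord a (k : R) : 0 <= k -> (forall i, `|a 0 i| <= k) ->
  enorm a <= m.+1%:R * k.
Proof.
move=> k0 ak; rewrite -(@ler_pXn2r _ 2%N) ?nnegrE ?enorm_ge0 ?mulr_ge0//.
rewrite sqr_enorm; apply: (@le_trans _ _ (\sum_(i < m) k ^+ 2)).
  apply: ler_sum => i _; rewrite -expr2 -(@real_normK _ (a 0 i)) ?num_real//.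
  by rewrite ler_pXn2r// nnegrE.
rewrite sumr_const card_ord -(mulr_natl (k ^+ 2) m) exprMn ler_wpM2r ?sqr_ge0//.
by rewrite -natrX ler_nat (leq_trans (leqnSn m))// expnS expn1 leq_pmulr.
Qed.

(** The ambient topology comes from the sup norm; equivalence of norms gives access to it through
    Euclidean balls. *)
Lemma nbhs_eballP a (A : set 'rV[R]_m) :
  nbhs a A <-> exists2 e : R, 0 < e & eball a e `<=` A.
Proof.
split=> [/nbhs_ballP[e /= e0 eA]|[e e0 eA]].
  exists e => // z; rewrite /eball/= => za; apply: eA.
  rewrite -ball_normE /ball_/= /Num.norm/= mx_normrE.
  apply: bigmax_lt => // -[i j] _ /=.
  rewrite !mxE distrC; apply: le_lt_trans za.
  by rewrite (ord1 i); have := ler_coord_enorm (z - a) j; rewrite !mxE.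
(* Dividing by [m + 2] rather than [m + 1] makes the final inequality strict. *)
apply/nbhs_ballP; exists (e / m.+2%:R) => /=; first by rewrite divr_gt0.
move=> z; rewrite -ball_normE /ball_/= /Num.norm/= mx_normrE => za; apply: eA.
rewrite /eball/=; apply: (@le_lt_trans _ _ (m.+1%:R * (e / m.+2%:R))).
  apply: ler_enorm_coord; first by rewrite divr_ge0// ltW.
  move=> j; apply: ltW; apply: le_lt_trans za.
  have := le_bigmax 0 (fun ij : 'I_1 * 'I_m => `|(a - z) ij.1 ij.2|) (0, j).
  by rewrite /= !mxE distrC.
by rewrite mulrCA gtr_pMr// ltr_pdivrMr// mul1r ltr_nat.
Qed.

Lemma closure_eballP (A : set 'rV[R]_m) a :
  closure A a <-> forall e : R, 0 < e -> exists2 b, A b & edist b a < e.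
Proof.
split=> [Aa e e0|H B /nbhs_eballP[e e0 eB]].
  have /Aa[b [Ab ab]] : nbhs a (eball a e) by apply/nbhs_eballP; exists e.
  by exists b.
by have [b Ab ba] := H _ e0; exists b; split=> //; apply: eB.
Qed.

End Euclidean.

(** * Lipschitz images of compact sets *)

Section LipschitzImages.
Context {R : realType} {m k : nat}.

Lemma compact_lipschitz_image (A : set 'rV[R]_m) (f : 'rV[R]_m -> 'rV[R]_k) (L : R) :
  compact A -> 0 < L ->
  (forall a b, A a -> A b -> edist (f a) (f b) <= L * edist a b) ->
  compact (f @` A).
Proof.
move=> cA L0 fL; apply: continuous_compact => //.
apply/subspace_continuousP => a Aa B /nbhs_eballP[e e0 eB].
apply/nbhs_eballP; exists (e / L); first exact: divr_gt0.
move=> z za Az; apply: eB; apply: (le_lt_trans (fL _ _ Az Aa)).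
by rewrite mulrC -ltr_pdivlMr.
Qed.

Lemma compact_edist_closed (A : set 'rV[R]_m) : compact A ->
  forall a, (forall e : R, 0 < e -> exists2 b, A b & edist b a < e) -> A a.
Proof.
move=> cA a Aa.
have Acl : closed A by apply: compact_closed => //; exact: norm_hausdorff.
by apply: Acl; apply/closure_eballP.
Qed.
End LipschitzImages.

(** * Convexity of finite cones and balls inside them *)

Definition segment_closed {R : realType} {m} (E : set 'rV[R]_m) :=
  forall a b (t : R), E a -> E b -> 0 <= t <= 1 -> E ((1 - t) *: a + t *: b).

Section Cones.
Context {R : realType} {m : nat}.
Implicit Types (a b c : 'rV[R]_m) (C : set 'rV[R]_m).

Lemma ecball_convex c (s : R) : segment_closed (ecball c s).
Proof.
move=> a b t; rewrite /ecball/= /edist => ac bc /andP[t0 t1].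
have -> : (1 - t) *: a + t *: b - c = (1 - t) *: (a - c) + t *: (b - c).
  by apply/rowP => i; rewrite !mxE; ring.
apply: (le_trans (ler_enormD _ _)); rewrite !enormZ !ger0_norm ?subr_ge0//.
have -> : s = (1 - t) * s + t * s by ring.
by apply: lerD; apply: ler_wpM2l; rewrite ?subr_ge0.
Qed.

Lemma finite_closed_cone0_convex C : finite_closed_cone 0 C -> segment_closed C.
Proof.
move=> [rho [c [s [rho0 [s0 [_ ->]]]]]] a b t.
move=> [a' [aB [k [w [k0 [wB a'E]]]]] <-] [b' [bB [l [v [l0 [vB b'E]]]]] <-] t01.
have /andP[t0 t1] := t01.
exists ((1 - t) *: a' + t *: b'); last by rewrite !add0r.
split; first exact: ecball_convex.
have k1 : 0 <= (1 - t) * k by rewrite mulr_ge0// subr_ge0.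
have l1 : 0 <= t * l by rewrite mulr_ge0.
rewrite a'E b'E !scalerA.
have [kl0|kl0] := eqVneq ((1 - t) * k + t * l) 0.
  exists 0, w; split => //; split => //.
  have [-> ->] : (1 - t) * k = 0 /\ t * l = 0 by split; lra.
  by rewrite !scale0r addr0.
have klp : 0 < (1 - t) * k + t * l by rewrite lt_neqAle eq_sym kl0 addr_ge0.
(* The sum of the two multiples is the total weight times a convex combination of [w] and [v], with
   [q] the share of [v]. *)
pose q := t * l / ((1 - t) * k + t * l).
exists ((1 - t) * k + t * l), ((1 - q) *: w + q *: v); split; first exact: addr_ge0.
split.
  apply: ecball_convex => //; apply/andP; split; first exact: divr_ge0 l1 (ltW klp).
  by rewrite /q ler_pdivrMr// mul1r lerDr.
rewrite scalerDr !scalerA; congr (_ *: _ + _ *: _).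
  by rewrite /q; field.
by rewrite /q; field.
Qed.

Lemma finite_closed_cone0_ecball C : finite_closed_cone 0 C ->
  exists (rho : R) c (s : R), [/\ 0 < rho, 0 < s, C `<=` ecball 0 rho & ecball c s `<=` C].
Proof.
move=> [rho [c [s [rho0 [s0 [_ ->]]]]]].
have cs0 : 0 < enorm c + s by rewrite ltr_wpDl ?enorm_ge0.
(* The generating ball scaled by [l] fits into the truncating ball: [l * (enorm c + s) = rho]. *)
pose l := rho / (enorm c + s); have l0 : 0 < l by rewrite divr_gt0.
exists rho, (l *: c), (l * s); split => //; first by rewrite mulr_gt0.
  by move=> _ [y [yB _] <-]; rewrite add0r.
move=> z; rewrite /ecball/= /edist => zc.
exists z; last by rewrite add0r.
split.
  rewrite /ecball/= /edist subr0 -(subrK (l *: c) z).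
  apply: (le_trans (ler_enormD _ _)); rewrite enormZ gtr0_norm//.
  apply: (@le_trans _ _ (l * s + l * enorm c)); first by rewrite lerD2r.
  by rewrite -mulrDr addrC /l divfK ?gt_eqF.
exists l, (l^-1 *: z); split; first exact: ltW.
split; last by rewrite scalerA mulfV ?gt_eqF// scale1r.
rewrite /ecball/= /edist.
have -> : l^-1 *: z - c = l^-1 *: (z - l *: c).
  by rewrite scalerBr scalerA mulVf ?gt_eqF// scale1r.
by rewrite enormZ gtr0_norm ?invr_gt0// ler_pdivrMl.
Qed.

End Cones.

(** * Rigid motions *)

Section RigidMotions.
Context {R : realType} {m : nat}.
Context (g : 'rV[R]_m -> 'rV[R]_m) (rg : rigid g).
Implicit Types (a b c : 'rV[R]_m) (A : set 'rV[R]_m).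

Let h a := g a - g 0.

(** Polarization: [h] fixes 0 and preserves distances, hence inner products. *)
Let dot_h a b : dot (h a) (h b) = dot a b.
Proof.
have hE x y : dot (h x - h y) (h x - h y) = dot (x - y) (x - y).
  rewrite -!sqr_enorm; congr (_ ^+ 2); rewrite -/(edist x y) -rg /edist.
  by congr enorm; apply/rowP => i; rewrite !mxE; ring.
have h0 : h 0 = 0 by rewrite /h subrr.
have h0E x : dot (h x) (h x) = dot x x by have := hE x 0; rewrite h0 !subr0.
have := hE a b; have := h0E a; have := h0E b.
move: (h a) (h b) => x y; rewrite !dotE (dotC b a) (dotC y x); lra.
Qed.

(** For [h], the squared norm of the difference of the two sides expands into inner products, all
    preserved by [h], and so vanishes. *)
Lemma rigid_segment a b (t : R) :
  g ((1 - t) *: a + t *: b) = (1 - t) *: g a + t *: g b.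
Proof.
pose c := (1 - t) *: a + t *: b.
suff hc : h c = (1 - t) *: h a + t *: h b.
  have -> : g c = h c + g 0 by rewrite /h subrK.
  by rewrite hc; apply/rowP => i; rewrite !mxE; ring.
apply/subr0_eq/enorm_eq0/eqP; rewrite -sqrf_eq0 sqr_enorm.
have [[aa ab] bb] := (dot_h a a, dot_h a b, dot_h b b).
have [[cc ca] cb] := (dot_h c c, dot_h c a, dot_h c b).
move: (h a) (h b) (h c) aa ab bb cc ca cb => x y z aa ab bb cc ca cb.
rewrite !dotE (dotC x z) (dotC y z) (dotC y x) aa ab bb cc ca cb.
by rewrite /c !dotE (dotC b a); apply/eqP; ring.
Qed.

Lemma rigid_image_convex A : segment_closed A -> segment_closed (g @` A).
Proof.
move=> cA _ _ t [a Aa <-] [b Ab <-] t01; rewrite -rigid_segment.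
by exists ((1 - t) *: a + t *: b) => //; apply: cA.
Qed.

(* The images under h of the standard basis form an orthonormal family of
   m vectors; a square matrix with orthonormal rows has an orthogonal inverse. *)
Lemma rigid_surj b : exists a, g a = b.
Proof.
pose A : 'M[R]_m := \matrix_(i < m) h (delta_mx 0 i).
have AAT : A *m A^T = 1%:M.
  apply/matrixP => i j; rewrite !mxE.
  transitivity (dot (h (delta_mx 0 i)) (h (delta_mx 0 j))).
    by apply: eq_bigr => k _; rewrite !mxE.
  by rewrite dot_h dot_delta mxE eqxx eq_sym.
have ATA := mulmx1C AAT.
pose u := (b - g 0) *m A^T.
exists u; suff: h u = b - g 0 by move=> /(congr1 (+%R^~ (g 0))); rewrite /h !subrK.
apply/subr0_eq; rewrite -[LHS]mulmx1 -ATA mulmxA.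
suff -> : (h u - (b - g 0)) *m A^T = 0 by rewrite mul0mx.
rewrite mulmxBl -/u; suff -> : h u *m A^T = u by rewrite subrr.
apply/rowP => k; rewrite mxE.
transitivity (dot (h u) (h (delta_mx 0 k))).
  by apply: eq_bigr => j _; rewrite !mxE.
exact: etrans (dot_h _ _) (dot_delta _ _).
Qed.

Lemma rigid_image_ecball c (s : R) : ecball (g c) s `<=` g @` ecball c s.
Proof.
move=> b; have [a <-] := rigid_surj b.
by rewrite /ecball/= rg => ac; exists a.
Qed.

End RigidMotions.

(** * The hyperplane as a copy of the lower-dimensional space *)

Section Embedding.
Context {R : realType} {n : nat}.
Implicit Types a b : 'rV[R]_n.+1.

Lemma emb_max a : emb n a 0 ord_max = 0.
Proof. by rewrite mxE /= ltnn. Qed.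

Lemma emb_segment a b (t : R) :
  emb n ((1 - t) *: a + t *: b) = (1 - t) *: emb n a + t *: emb n b.
Proof. by apply/rowP => i; rewrite !mxE; case: ifP => _; rewrite ?mxE// !mulr0 addr0. Qed.

Lemma emb_isometry a b : edist (emb n a) (emb n b) = edist a b.
Proof.
rewrite /edist /enorm big_ord_recr/= !mxE /= ltnn subrr expr0n addr0.
congr Num.sqrt; apply: eq_bigr => i _.
by rewrite !mxE /= ltn_ord inord_val.
Qed.

Lemma emb_onto_piN (w : 'rV[R]_n.+2) : piN n w -> exists a, emb n a = w.
Proof.
move=> w0; exists (\row_i w 0 (widen_ord (leqnSn n.+1) i)).
apply/rowP => i; rewrite !mxE; case: ifP => i_n; last first.
  have -> // : i = ord_max.
  by apply/val_inj/eqP; rewrite /= eqn_leq -ltnS ltn_ord leqNgt i_n.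
by congr (w _ _); apply/val_inj; rewrite /= inordK.
Qed.

Lemma emb_image_convex (E : set 'rV[R]_n.+1) :
  segment_closed E -> segment_closed (emb n @` E).
Proof.
move=> cE _ _ t [a Ea <-] [b Eb <-] t01; rewrite -emb_segment.
by exists ((1 - t) *: a + t *: b) => //; apply: cE.
Qed.

Lemma piN_convex : segment_closed (@piN R n).
Proof.
by move=> a b t; rewrite /piN/= !mxE => -> -> _; rewrite !mulr0 addr0.
Qed.

End Embedding.

(** * Finite nets of size controlled by the diameter *)

(* Cells of a cubic grid of mesh e / (m + 1) anchored at a point of the set. *)
Lemma uniform_finite_net (R : realType) (m : nat) (D e : R) : 0 < e ->
  exists M : nat, forall S : set 'rV[R]_m, S !=set0 ->
    (forall a b, S a -> S b -> edist a b <= D) ->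
    exists s : nat -> 'rV[R]_m, (forall i, S (s i)) /\
      forall a, S a -> exists2 i, (i < M)%N & edist a (s i) <= e.
Proof.
move=> e0; pose h := e / m.+1%:R.
have h0 : 0 < h by rewrite divr_gt0.
(* Shifted by [D], coordinates relative to the anchor lie between 0 and [D + D], so cell indices are
   at most [q]. *)
pose q := Num.truncn ((D + D) / h).
exists #|{ffun 'I_m -> 'I_q.+1}| => S [a0 Sa0] SD.
pose cell (a : 'rV[R]_m) : {ffun 'I_m -> 'I_q.+1} :=
  [ffun i => inord (Num.truncn ((a 0 i - a0 0 i + D) / h))].
have coordD a i : S a -> 0 <= (a 0 i - a0 0 i + D) / h <= (D + D) / h.
  move=> Sa; have := le_trans (ler_coord_enorm (a - a0) i) (SD _ _ Sa Sa0).
  rewrite !mxE ler_norml => /andP[l u].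
  by rewrite divr_ge0 ?(ltW h0)//= 1?ler_pM2r ?invr_gt0//; lra.
have cellE a b : S a -> S b -> cell a = cell b -> edist a b <= e.
  move=> Sa Sb ab; rewrite /edist.
  have -> : e = m.+1%:R * h by rewrite mulrC divfK// pnatr_eq0.
  apply: ler_enorm_coord => [|i]; first exact: ltW.
  have /andP[la ua] := coordD a i Sa; have /andP[lb ub] := coordD b i Sb.
  have := congr1 (fun f : {ffun 'I_m -> 'I_q.+1} => val (f i)) ab.
  rewrite !ffunE/= !inordK ?ltnS ?le_truncn// => tab.
  have := truncn_itv la; have := truncn_itv lb; rewrite tab.
  move: (Num.truncn _) => k /andP[].
  rewrite ler_pdivlMr// ltr_pdivrMr// => l1 u1 /andP[].
  rewrite ler_pdivlMr// ltr_pdivrMr// => l2 u2.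
  rewrite !mxE -[k.+1]addn1 natrD mulrDl mul1r in u1 u2 *.
  by rewrite ler_norml; apply/andP; split; lra.
(* Each cell meeting [S] gets a representative in [S]; the other cells get the anchor [a0]. *)
have /choice[s sP] : forall j : {ffun 'I_m -> 'I_q.+1}, exists b, S b /\
    forall a, S a -> cell a = j -> edist a b <= e.
  move=> j; have [[b [Sb bj]]|no] := pselect (exists b, S b /\ cell b = j).
    by exists b; split => // a Sa aj; apply: cellE; rewrite ?aj.
  by exists a0; split => // a Sa aj; case: no; exists a.
pose t k := if insub k is Some o then s (enum_val (o : 'I_#|{ffun 'I_m -> 'I_q.+1}|)) else a0.
exists t; split=> [k|a Sa].
  by rewrite /t; case: insubP => [j|] // _ _; have [] := sP (enum_val j).
exists (enum_rank (cell a)); first exact: ltn_ord.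
rewrite /t valK enum_rankK.
by have [_] := sP (cell a); apply.
Qed.

(** * Householder reflections *)

Section Householder.
Context {R : realType} {m : nat}.
Implicit Types (v x y : 'rV[R]_m).

(** Reflection in the hyperplane orthogonal to [v], and the identity for [v = 0]. *)
Definition reflection v x := x - (2 * dot x v / dot v v) *: v.

Lemma reflectionB v x y : reflection v (x - y) = reflection v x - reflection v y.
Proof. by rewrite /reflection dotDl dotNl; apply/rowP => i; rewrite !mxE; ring. Qed.

Lemma reflection_coord v x i : v 0 i = 0 -> reflection v x 0 i = x 0 i.
Proof. by move=> v0; rewrite !mxE v0 mulr0 subr0. Qed.

Lemma dot_reflection v x y : dot (reflection v x) (reflection v y) = dot x y.
Proof.
have [v0|v0] := eqVneq (dot v v) 0.
  by rewrite /reflection v0 invr0 !mulr0 !scale0r !subr0.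
by rewrite /reflection !dotE (dotC v y); field.
Qed.

Lemma edist_reflection v x y : edist (reflection v x) (reflection v y) = edist x y.
Proof. by rewrite /edist -reflectionB !enorm_sqrt_dot dot_reflection. Qed.

Lemma reflection_swap x y : dot x x = 1 -> dot y y = 1 -> reflection (x - y) x = y.
Proof.
move=> x1 y1; have [xy0|xy0] := eqVneq (dot (x - y) (x - y)) 0.
  rewrite /reflection xy0 invr0 mulr0 scale0r subr0; apply/subr0_eq/enorm_eq0.
  by rewrite enorm_sqrt_dot xy0 sqrtr0.
rewrite /reflection -[X in X - _]scale1r.
have -> : 2 * dot x (x - y) / dot (x - y) (x - y) = 1.
  have <- : dot (x - y) (x - y) = 2 * dot x (x - y).
    by rewrite !dotE (dotC y x) x1 y1; ring.
  by rewrite mulfV.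
by apply/rowP => i; rewrite !mxE; ring.
Qed.

End Householder.

(** * Folding along a Lipschitz graph *)

(* [fold] exchanges the part of the space below the graph of the
   [kappa]-Lipschitz function [graph] over the hyperplane orthogonal to [e]
   with a half-space; as an involution it is bi-Lipschitz once it is Lipschitz. *)
Section GraphFold.
Context {R : realType} {m : nat}.
Context (e : 'rV[R]_m) (A : set 'rV[R]_m) (kappa : R).
Hypotheses (e1 : dot e e = 1) (A0 : A !=set0) (Ab : ebounded A) (kappa0 : 0 < kappa).
Implicit Types (v w a b : 'rV[R]_m).

Definition perp w := w - dot w e *: e.

(** The least [kappa]-Lipschitz function over the hyperplane lying above [A]: the upper envelope of
    downward cones of slope [kappa] with apexes in [A]. *)
Definition graph v : R := sup [set dot a e - kappa * enorm (v - perp a) | a in A].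

Definition fold w := perp w + (graph (perp w) - dot w e) *: e.

Lemma perpB a b : perp (a - b) = perp a - perp b.
Proof. by rewrite /perp !dotE; apply/rowP => i; rewrite !mxE; ring. Qed.

Lemma dot_perp w : dot (perp w) e = 0.
Proof. by rewrite /perp !dotE e1; ring. Qed.

Lemma perp_shift w (s : R) : perp (perp w + s *: e) = perp w.
Proof.
by rewrite {1}/perp dotDl dot_perp dotZl e1; apply/rowP => i; rewrite !mxE; ring.
Qed.

Lemma ler_enorm_perp w : enorm (perp w) <= enorm w.
Proof.
rewrite -(@ler_pXn2r _ 2%N) ?nnegrE ?enorm_ge0// !sqr_enorm.
rewrite {2}/perp dotDr dotNr dotZr dot_perp mulr0 subr0 /perp !dotE (dotC e).
have := sqr_ge0 (dot w e); lra.
Qed.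

Lemma ler_dot_unit w : `|dot w e| <= enorm w.
Proof.
by have := ler_norm_dot w e; rewrite (enorm_sqrt_dot e) e1 sqrtr1 mulr1.
Qed.

Let graph_has_sup v :
  has_sup [set dot a e - kappa * enorm (v - perp a) | a in A].
Proof.
split; first by have [a Aa] := A0; exists (dot a e - kappa * enorm (v - perp a)), a.
have [M AM] := Ab; exists M => _ [a Aa <-].
have := le_trans (ler_norm _) (le_trans (ler_dot_unit a) (AM _ Aa)).
have : 0 <= kappa * enorm (v - perp a) by rewrite mulr_ge0 ?enorm_ge0// ltW.
lra.
Qed.

Lemma graph_ub v a : A a -> dot a e - kappa * enorm (v - perp a) <= graph v.
Proof. by move=> Aa; apply: (sup_upper_bound (graph_has_sup v)); exists a. Qed.

Lemma graph_approx v (s : R) : s < graph v ->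
  exists2 a, A a & s < dot a e - kappa * enorm (v - perp a).
Proof.
move=> sv; have [|_ [a Aa <-] sa] := @sup_adherent _ _ (graph v - s) _ (graph_has_sup v).
  by rewrite subr_gt0.
by exists a => //; move: sa; rewrite -/(graph v) opprB addrC subrK.
Qed.

Let graph_lip1 v w : graph v <= graph w + kappa * edist v w.
Proof.
apply: sup_le_ub; first by have [] := graph_has_sup v.
move=> _ [a Aa <-]; have := graph_ub w a Aa.
have : kappa * enorm (w - perp a) <= kappa * (edist w v + enorm (v - perp a)).
  by rewrite ler_pM2l//; apply: edist_triangle.
rewrite (edistC w) mulrDr; lra.
Qed.

Lemma graph_lipschitz v w : `|graph v - graph w| <= kappa * edist v w.
Proof.
have := graph_lip1 v w; have := graph_lip1 w v; rewrite (edistC w) ler_norml => ? ?.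
by apply/andP; split; lra.
Qed.

(** Over a fixed base point, [fold] sends the height [s] to [graph - s]. *)
Lemma foldK : involutive fold.
Proof.
move=> w; rewrite /fold perp_shift dotDl dot_perp dotZl e1 /perp.
by apply/rowP => i; rewrite !mxE; ring.
Qed.

Lemma dot_fold w : dot (fold w) e = graph (perp w) - dot w e.
Proof. by rewrite /fold dotDl dot_perp dotZl e1 add0r mulr1. Qed.

Lemma fold_coord w i : e 0 i = 0 -> fold w 0 i = w 0 i.
Proof. by move=> ei; rewrite /fold /perp !mxE ei; ring. Qed.

Lemma fold_lipschitz v w : edist (fold v) (fold w) <= (2 + kappa) * edist v w.
Proof.
rewrite {1}/edist.
have -> : fold v - fold w = perp (v - w) +
    ((graph (perp v) - graph (perp w)) - dot (v - w) e) *: e.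
  by rewrite perpB /fold dotDl dotNl; apply/rowP => i; rewrite !mxE; ring.
apply: (le_trans (ler_enormD _ _)).
rewrite enormZ (enorm_sqrt_dot e) e1 sqrtr1 mulr1.
have := ler_enorm_perp (v - w); have := ler_dot_unit (v - w).
have := graph_lipschitz (perp v) (perp w).
have : kappa * edist (perp v) (perp w) <= kappa * edist v w.
  by rewrite ler_pM2l// /edist -perpB ler_enorm_perp.
have := ler_normB (graph (perp v) - graph (perp w)) (dot (v - w) e).
rewrite -/(edist v w); lra.
Qed.

Lemma fold_lower v w : (2 + kappa)^-1 * edist v w <= edist (fold v) (fold w).
Proof.
have := fold_lipschitz (fold v) (fold w); rewrite !foldK.
by rewrite ler_pdivrMl// addr_gt0.
Qed.

End GraphFold.

(** * Closed sets star-shaped with respect to a ball *)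

Section StarShaped.
Context {R : realType} {n : nat}.
Context (U : set 'rV[R]_n.+2) (p : 'rV[R]_n.+2) (rho R0 : R).
Hypotheses (rho0 : 0 < rho) (R00 : 0 < R0) (pip : piN n p).
Hypotheses (Upi : U `<=` piN n) (UR0 : U `<=` ecball p R0).
Hypothesis Ucl : forall w, (forall d : R, 0 < d -> exists2 a, U a & edist a w < d) -> U w.
Hypothesis Ustar : forall a b (t : R), U a -> piN n b -> eball p rho b ->
  0 <= t <= 1 -> U ((1 - t) *: a + t *: b).

(** A ball of radius [rho / 2] seen from distance at most [R0] gives this slope; the other half of
    [rho] absorbs moving the apex near [u]. *)
Let kappa := 2 * R0 / rho.
Let kappa0 : 0 < kappa. Proof. by rewrite divr_gt0// mulr_gt0. Qed.

(** * Flattening near a boundary point *)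

Section BoundaryPoint.
Context (u e : 'rV[R]_n.+2).
Hypotheses (Uu : U u) (pu : rho <= edist u p) (upE : u - p = edist u p *: e).

Let A := U `&` ecball u (rho / 4).

Let up0 : 0 < edist u p. Proof. exact: lt_le_trans pu. Qed.

Let eE : e = (edist u p)^-1 *: (u - p).
Proof. by rewrite upE scalerA mulVf ?gt_eqF// scale1r. Qed.

Let pie : piN n e.
Proof. by rewrite eE /piN/= !mxE (Upi _ Uu) pip subrr mulr0. Qed.

Let e1 : dot e e = 1.
Proof.
rewrite eE dotZl dotZr -sqr_enorm -/(edist u p).
by field; rewrite gt_eqF.
Qed.

Let A0 : A !=set0.
Proof. by exists u; split=> //; rewrite /ecball/= edistxx divr_ge0// ltW. Qed.

Let Ab : ebounded A.
Proof.
exists (R0 + enorm p) => a [Ua _]; rewrite -(subrK p a).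
by apply: (le_trans (ler_enormD _ _)); rewrite lerD2r; exact: UR0.
Qed.

(* A point lying below a in a cone of opening 1 / kappa around -e is a convex
   combination of a and of a point of the ball around p. *)
Let below_in (a v : 'rV[R]_n.+2) : A a -> edist (a - v) u <= rho / 4 + rho / 4 -> piN n (a - v) ->
  kappa * enorm (perp e v) < dot v e -> U (a - v).
Proof.
move=> [Ua ua] uw piw vk.
have vs0 : 0 < dot v e by apply: le_lt_trans vk; rewrite mulr_ge0 ?enorm_ge0// ltW.
have aE : a - p = edist u p *: e + (a - u) by rewrite -upE [RHS]addrC subrKA.
have [sa sE] : exists sa, sa = dot (a - p) e by eexists.
have saE : sa = edist u p + dot (a - u) e.
  by rewrite sE aE (dotDl (edist u p *: e)) dotZl e1 mulr1.
have dau := le_trans (ler_dot_unit _ e1 (a - u)) ua.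
have dv : enorm v <= rho / 4 + (rho / 4 + rho / 4).
  have -> : v = (a - u) - ((a - v) - u) by apply/rowP => i; rewrite !mxE; ring.
  by apply: (le_trans (ler_enormD _ _)); rewrite enormN; apply: lerD.
have {}dv := le_trans (ler_dot_unit _ e1 v) dv.
rewrite ler_norml in dau; have /andP[dau1 dau2] := dau.
rewrite ler_norml in dv; have /andP[dv1 dv2] := dv.
have sal : rho - rho / 4 <= sa by rewrite saE lerD.
have sap : 0 < sa by lra.
(* The line from [a] along [- v] meets the hyperplane through [p] orthogonal to [e] at [b]; [t <= 1]
   because [dot v e <= 3 / 4 * rho <= sa]. *)
pose t := dot v e / sa.
pose b := p + perp e (a - p) - (sa / dot v e) *: perp e v.
have -> : a - v = (1 - t) *: a + t *: b.
  rewrite /b /t; apply/rowP => i; rewrite /perp -sE !mxE.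
  by field; rewrite !gt_eqF.
apply: Ustar => //.
- have vN : v 0 ord_max = 0 by have := piw; rewrite /piN/= !mxE (Upi _ Ua); lra.
  by rewrite /b /perp /piN/= !mxE pip (Upi _ Ua) vN pie; ring.
- rewrite /eball/= /edist.
  have -> : b - p = perp e (a - u) - (sa / dot v e) *: perp e v.
    rewrite /b aE {1}/perp dotDl dotZl e1 [in RHS]/perp.
    by apply/rowP => i; rewrite !mxE; ring.
  apply: (le_lt_trans (ler_enormD _ _)); rewrite enormN enormZ.
  rewrite (ger0_norm (divr_ge0 (ltW sap) (ltW vs0))).
  have h1 := le_trans (ler_enorm_perp _ e1 (a - u)) ua.
  suff h2 : sa / dot v e * enorm (perp e v) <= rho / 2 by lra.
  rewrite mulrAC ler_pdivrMr//.
  apply: (@le_trans _ _ (R0 * enorm (perp e v))).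
    rewrite ler_wpM2r ?enorm_ge0// sE.
    exact: le_trans (ler_norm _) (le_trans (ler_dot_unit _ e1 _) (UR0 _ Ua)).
  have -> : R0 = rho / 2 * kappa by rewrite /kappa; field; rewrite gt_eqF.
  by rewrite -mulrA ler_wpM2l ?ltW// divr_gt0.
- rewrite divr_ge0 ?(ltW vs0) ?(ltW sap)//= ler_pdivrMr// mul1r; lra.
Qed.

(** The supremum is not known to be attained, so [w] is lowered by a small [s] to lie strictly under
    the cone of some [a]; closedness of [U] then returns to [w]. *)
Let under_graph_in (w : 'rV[R]_n.+2) : piN n w -> edist w u <= rho / 4 ->
  dot w e <= graph e A kappa (perp e w) -> U w.
Proof.
move=> piw wu wg; apply: Ucl => d d0.
pose s := Num.min (d / 2) (rho / 4).
have s0 : 0 < s by rewrite /s lt_min !divr_gt0.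
have sd : s < d by rewrite gt_min ltr_pdivrMr// ltr_pMr// ltr1n.
have srho : s <= rho / 4 by rewrite ge_min lexx orbT.
have se : edist (w - s *: e) w = s.
  rewrite /edist addrC addKr enormN enormZ (enorm_sqrt_dot e) e1 sqrtr1 mulr1.
  by rewrite gtr0_norm.
exists (w - s *: e); last by rewrite se.
have [|a Aa] := graph_approx e A kappa e1 A0 Ab kappa0 (perp e w) (dot w e - s).
  by lra.
have [v vE] : exists v, v = a - (w - s *: e) by eexists.
have <- : a - v = w - s *: e by rewrite vE opprB addrC subrK.
move=> hv; apply: below_in => //.
- rewrite vE opprB addrC subrK.
  apply: (le_trans (edist_triangle w _ _)); rewrite se; lra.
- by rewrite vE opprB addrC subrK /piN/= !mxE piw pie mulr0 subrr.
- have -> : perp e v = - (perp e w - perp e a).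
    rewrite vE /perp !dotE e1; apply/rowP => i; rewrite !mxE; ring.
  rewrite enormN vE !dotE e1; lra.
Qed.

(** If [u] were strictly below the graph, Lipschitz continuity would keep a whole neighbourhood of
    [u] in the hyperplane below it, hence in [U]. *)
Let graph_at : ~ (exists2 d : R, 0 < d & eball u d `&` piN n `<=` U) ->
  graph e A kappa (perp e u) = dot u e.
Proof.
move=> nint; apply/eqP; rewrite eq_le; apply/andP; split; last first.
  have Au : A u by split=> //; rewrite /ecball/= edistxx divr_ge0// ltW.
  have := graph_ub e A kappa e1 A0 Ab kappa0 (perp e u) u Au.
  by rewrite subrr enorm0 mulr0 subr0.
rewrite leNgt; apply/negP => gap; apply: nint.
pose g := graph e A kappa (perp e u) - dot u e.
have g0 : 0 < g by rewrite subr_gt0.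
have k1 : 0 < 1 + kappa by rewrite addr_gt0.
(* The height and [graph] together change by at most [(1 + kappa) * edist w u], which stays below
   the gap [g]. *)
exists (Num.min (rho / 4) (g / (1 + kappa))); first by rewrite lt_min !divr_gt0.
move=> w []; rewrite /eball/= lt_min => /andP[w1 w2] piw.
rewrite ltr_pdivlMr// in w2; apply: (under_graph_in w piw (ltW w1)).
have := graph_lipschitz e A kappa e1 A0 Ab kappa0 (perp e w) (perp e u).
have : kappa * edist (perp e w) (perp e u) <= kappa * edist w u.
  by rewrite ler_pM2l// /edist -perpB ler_enorm_perp.
have := ler_dot_unit _ e1 (w - u); rewrite -/(edist w u) dotDl dotNl.
rewrite !ler_norml => /andP[h1 h2] h3 /andP[h4 h5].
rewrite /g in w2; lra.
Qed.

(** [T] folds along the graph, translates the image of [u] to 0 and reflects [e] to the axis [f]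
    whose coordinate defines [piplus]. The last coordinate survives since [e] and [f] lie in the
    hyperplane. *)
Lemma boundary_flattening :
  ~ (exists2 d : R, 0 < d & eball u d `&` piN n `<=` U) ->
  exists T : 'rV[R]_n.+2 -> 'rV[R]_n.+2,
    [/\ T u = 0,
        forall v w, (2 + kappa)^-1 * edist v w <= edist (T v) (T w) /\
                    edist (T v) (T w) <= (2 + kappa) * edist v w,
        forall w, T w 0 ord_max = w 0 ord_max &
        forall w, edist w u <= rho / 4 -> (U w <-> piplus n (T w))].
Proof.
move=> nint; have gu := graph_at nint.
pose f : 'rV[R]_n.+2 := delta_mx 0 (inord n).
have f1 : dot f f = 1 by rewrite dot_delta mxE !eqxx.
have fN : f 0 ord_max = 0.
  rewrite mxE; case: eqP => // _; case: eqP => // /(congr1 val)/=.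
  by rewrite inordK// => /eqP; rewrite eqn_leq ltnn.
pose S := fold e A kappa; pose T w := reflection (e - f) (S w - S u).
(* The reflection carries [e] to [f], so this coordinate is the height of [S w] above [S u], and
   [S u] has height 0 by [gu]. *)
have TE w : T w 0 (inord n) = graph e A kappa (perp e w) - dot w e.
  rewrite -dot_delta -/f -[X in dot _ X](reflection_swap e f e1 f1) dot_reflection.
  by rewrite dotDl dotNl !dot_fold// gu; ring.
have TN w : T w 0 ord_max = w 0 ord_max.
  have SN v : S v 0 ord_max = v 0 ord_max by rewrite /S fold_coord.
  have subE (a b : 'rV[R]_n.+2) i : (a - b) 0 i = a 0 i - b 0 i by rewrite !mxE.
  by rewrite reflection_coord !subE ?SN ?(Upi _ Uu) ?subr0// fN pie subr0.
have TB v w : edist (T v) (T w) = edist (S v) (S w).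
  by rewrite edist_reflection /edist; congr enorm; rewrite opprB addrA subrK.
exists T; split => //.
- rewrite /T /reflection subrr /dot big1 ?mulr0 ?mul0r ?scale0r ?subr0// => i _.
  by rewrite mxE mul0r.
- by move=> v w; rewrite TB; split; [exact: fold_lower|exact: fold_lipschitz].
- move=> w wu; split => [Uw|[]].
    split; first by rewrite /piN/= TN (Upi _ Uw).
    have Aw : A w by split.
    have := graph_ub e A kappa e1 A0 Ab kappa0 (perp e w) w Aw.
    by rewrite TE subrr enorm0 mulr0 subr0 subr_ge0.
  by rewrite /piN/= TN TE subr_ge0 => piw wg; exact: under_graph_in.
Qed.

End BoundaryPoint.

(** * Pulling star-shaped sets back through a chart *)

Lemma starshaped_ball : U !=set0 -> eball p rho `&` piN n `<=` U.
Proof.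
move=> [a Ua] b [bp pib]; have := Ustar a b 1 Ua pib bp.
by rewrite subrr scale0r add0r scale1r; apply; rewrite ler01 lexx.
Qed.

Lemma starshaped_flattening u : U u ->
  ~ (exists2 d : R, 0 < d & eball u d `&` piN n `<=` U) ->
  exists T : 'rV[R]_n.+2 -> 'rV[R]_n.+2,
    [/\ T u = 0,
        forall v w, (2 + kappa)^-1 * edist v w <= edist (T v) (T w) /\
                    edist (T v) (T w) <= (2 + kappa) * edist v w,
        forall w, T w 0 ord_max = w 0 ord_max &
        forall w, edist w u <= rho / 4 -> (U w <-> piplus n (T w))].
Proof.
move=> Uu nint.
(* A point closer to [p] would be interior; hence the direction from [p] to [u] is defined. *)
have pu : rho <= edist u p.
  rewrite leNgt; apply/negP => up; apply: nint.
  exists (rho - edist u p); first by rewrite subr_gt0.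
  move=> w [wu piw]; apply: starshaped_ball; first by exists u.
  split => //; apply: (le_lt_trans (edist_triangle u _ _)).
  by rewrite -ltrBrDr.
apply: (boundary_flattening u ((edist u p)^-1 *: (u - p))) => //.
by rewrite scalerA mulfV ?scale1r// gt_eqF// (lt_le_trans rho0).
Qed.

(** The new charts are [Phi] followed by a translation at points whose image is interior to [U], and
    by the flattening map at the others. *)
Lemma starshaped_piece_MR (Omega K : set 'rV[R]_n.+2) (Phi : 'rV[R]_n.+2 -> 'rV[R]_n.+2)
    (x : 'rV[R]_n.+2) (r L : R) :
  0 < r -> 0 < L -> compact K -> K `<=` closure Omega ->
  (forall z1 z2, ecball x r z1 -> ecball x r z2 ->
     L^-1 * edist z1 z2 <= edist (Phi z1) (Phi z2) /\
     edist (Phi z1) (Phi z2) <= L * edist z1 z2) ->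
  U !=set0 -> U `<=` Phi @` (K `&` ecball x (3 / 4 * r)) ->
  classMR n Omega [set z | [/\ K z, ecball x (3 / 4 * r) z & U (Phi z)]]
    (Num.min (r / 4) (rho / (4 * L))) (L * (2 + kappa)).
Proof.
(* [r / 4] keeps the small balls inside the chart at [x]; [rho / (4 * L)] keeps their images within
   [rho / 4], where the flattening describes [U]. *)
move=> r0 L0 cK KO biL U0 UK; set H := [set z | _]; set r' := Num.min _ _.
have r'r : r' <= r / 4 by rewrite ge_min lexx.
have r'rho : L * r' <= rho / 4.
  apply: (@le_trans _ _ (L * (rho / (4 * L)))).
    by rewrite ler_pM2l// ge_min lexx orbT.
  by have -> // : L * (rho / (4 * L)) = rho / 4 by field; rewrite gt_eqF.
have r'0 : 0 < r' by rewrite lt_min !divr_gt0 ?mulr_gt0.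
have k2 : 0 < 2 + kappa by rewrite addr_gt0.
have HB h z : H h -> ecball h r' z -> ecball x r z.
  move=> [_ hx _] zh; apply: (le_trans (edist_triangle h _ _)).
  rewrite /ecball/= in hx zh; lra.
have HBx h : H h -> ecball x r h.
  by move=> Hh; apply: HB (Hh) _; rewrite /ecball/= edistxx ltW.
have near_image h z : H h -> ecball h r' z -> edist (Phi z) (Phi h) <= rho / 4.
  move=> Hh zh; have [_] := biL z h (HB _ _ Hh zh) (HBx _ Hh).
  move=> zh'; apply: (le_trans zh'); apply: le_trans r'rho.
  by rewrite ler_pM2l.
(* Injectivity of [Phi] identifies [z] with the point of [K] having the same image. *)
have inH z : ecball x r z -> U (Phi z) -> H z.
  move=> zx Uz; have [z' [Kz' z'x] z'z] := UK _ Uz.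
  suff <- : z' = z by split => //; rewrite z'z.
  apply: edist_eq0; apply/eqP; rewrite eq_le edist_ge0 andbT.
  have z'r : ecball x r z' by apply: (le_trans z'x); rewrite ler_piMl// ?(ltW r0)//; lra.
  have [+ _] := biL z' z z'r zx; rewrite z'z edistxx.
  by rewrite ler_pdivrMl// mulr0.
have cH : compact H.
  apply: (subclosed_compact _ cK); last by move=> z [].
  move=> z /closure_eballP zH.
  have Kz : K z.
    by apply: compact_edist_closed => // d /zH[b [Kb _ _] bz]; exists b.
  have zx : ecball x (3 / 4 * r) z.
    apply/ler_addgt0Pr => d /zH[b [_ bx _] bz].
    apply: (le_trans (edist_triangle b _ _)); rewrite edistC addrC.
    by apply: lerD => //; exact: ltW.
  have zr : ecball x r z by apply: (le_trans zx); rewrite ler_piMl// ?(ltW r0)//; lra.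
  split => //; apply: Ucl => d d0.
  have [b Hb bz] := zH _ (divr_gt0 d0 L0).
  exists (Phi b); first by have [] := Hb.
  have [_ bz'] := biL b z (HBx _ Hb) zr; apply: (le_lt_trans bz').
  by rewrite mulrC -ltr_pdivlMr.
have H0 : H !=set0.
  have [a Ua] := U0; have [z [Kz zx] za] := UK _ Ua.
  by exists z; split => //; rewrite za.
pose interior h := exists2 d : R, 0 < d & eball (Phi h) d `&` piN n `<=` U.
have /choice[T TP] : forall h, exists T : 'rV[R]_n.+2 -> 'rV[R]_n.+2, H h ->
    [/\ T (Phi h) = 0,
        forall v w, (2 + kappa)^-1 * edist v w <= edist (T v) (T w) /\
                    edist (T v) (T w) <= (2 + kappa) * edist v w,
        forall w, T w 0 ord_max = w 0 ord_max,
        interior h -> T = (fun w => w - Phi h) &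
        ~ interior h -> forall w, edist w (Phi h) <= rho / 4 ->
          (U w <-> piplus n (T w))].
  move=> h; have [Hh|] := pselect (H h); last by exists id.
  have [_ _ Uh] := Hh.
  have [inth|ninth] := pselect (interior h).
    exists (fun w => w - Phi h) => _; split => //.
    - exact: subrr.
    - move=> v w; have -> : edist (v - Phi h) (w - Phi h) = edist v w.
        by rewrite /edist opprB addrA subrK.
      have := edist_ge0 v w => vw0; split.
        by rewrite ler_pdivrMl// ler_peMl//; have := kappa0; lra.
      by rewrite ler_peMl//; have := kappa0; lra.
    - by move=> w; rewrite !mxE (Upi _ Uh) subr0.
  by have [T [T0 TB TN Tpi]] := starshaped_flattening _ Uh ninth; exists T.
exists (fun h z => T h (Phi z)); split.
  split => //; split => //; split; first by move=> z [] /KO.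
  move=> h Hh; have [T0 TB TN _ _] := TP h Hh; split.
    move=> z1 z2 z1h z2h.
    have [l u] := biL z1 z2 (HB _ _ Hh z1h) (HB _ _ Hh z2h).
    have [l' u'] := TB (Phi z1) (Phi z2); split.
      apply: le_trans l'; rewrite invfM mulrAC mulrC ler_pM2l ?invr_gt0//.
    apply: (le_trans u'); rewrite [L * _]mulrC -mulrA ler_pM2l//.
  split=> // _ [z [[_ _ Uz] _] <-].
  by rewrite /piN/= TN (Upi _ Uz).
move=> h Hh nint; have [T0 TB TN Tint Tbd] := TP h Hh; have [_ _ Uh] := Hh.
(* Interior points are defined through the new chart: were it a translation, a ball of the
   hyperplane around [Phi h] inside [U] would become one around 0, against [nint]. *)
have ninth : ~ interior h.
  move=> inth; apply: nint; have TE := Tint inth.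
  have [d d0 dU] := inth.
  (* The bound [r' / L] places the preimages within [r'] of [h]. *)
  exists (Num.min d (r' / L)); split; first by rewrite lt_min d0 divr_gt0.
  move=> v [vd piv].
  rewrite /eball/= lt_min in vd; have /andP[vd1 vd2] := vd.
  have vE : edist (Phi h + v) (Phi h) = edist v 0.
    by rewrite /edist addrC addKr subr0.
  have Uv : U (Phi h + v).
    apply: dU; split; first by rewrite /eball/= vE.
    by rewrite /piN/= mxE (Upi _ Uh) piv addr0.
  have [z [_ zx] zE] := UK _ Uv.
  have zr : ecball x r z by apply: (le_trans zx); rewrite ler_piMl// ?(ltW r0)//; lra.
  exists z; last by rewrite TE zE addrC addKr.
  split; first by apply: inH => //; rewrite zE.
  have [+ _] := biL z h zr (HBx _ Hh); rewrite zE vE ler_pdivrMl// => zh.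
  by apply: (le_lt_trans zh); rewrite mulrC -ltr_pdivlMr.
apply/seteqP; split => [_ [z [Hz zh] <-]|_ [[z zh <-] zpi]].
  have zh' : ecball h r' z by exact: ltW.
  split; first by exists z.
  by apply/(Tbd ninth _ (near_image _ _ Hh zh')); have [] := Hz.
have zh' : ecball h r' z by exact: ltW.
exists z => //; split => //; apply: inH; first exact: HB Hh zh'.
exact/(Tbd ninth _ (near_image _ _ Hh zh')).
Qed.

End StarShaped.

(** * Local pieces in one chart *)

Section LocalPieces.
Context {R : realType} {n : nat}.
Context (r L rho s : R) (C : set 'rV[R]_n.+1) (c0 : 'rV[R]_n.+1).
Context (r0 : 0 < r) (L0 : 0 < L) (rho0 : 0 < rho) (s0 : 0 < s).
Context (cC : segment_closed C) (Crho : C `<=` ecball 0 rho) (sC : ecball c0 s `<=` C).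

(* Shrinking a cone by this factor towards one of its points keeps its preimage
   under a chart within r / 4 of the preimage of that point. *)
Definition shrink_factor := Num.min 1 (r / (8 * L * rho)).

Let t := shrink_factor.

Lemma shrink_factor_gt0 : 0 < t.
Proof. by rewrite lt_min ltr01 divr_gt0// !mulr_gt0. Qed.

Let t0 := shrink_factor_gt0.

Let t01 : 0 <= t <= 1. Proof. by rewrite ltW// ge_min lexx. Qed.

Let tL : L * (t * (rho + rho)) <= r / 4.
Proof.
have h : t <= r / (8 * L * rho) by rewrite ge_min lexx orbT.
have -> : r / 4 = L * (r / (8 * L * rho) * (rho + rho)).
  by field; rewrite !gt_eqF.
by rewrite ler_pM2l// ler_pM2r// addr_gt0.
Qed.

Context (Omega K : set 'rV[R]_n.+2) (Phi : 'rV[R]_n.+2 -> 'rV[R]_n.+2) (x : 'rV[R]_n.+2).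

(** What is used of a shrunken cone copy. The radius [3 / 4 * r] is [r / 2] for the point it covers
    plus [r / 4] for its extent. *)
Definition chart_core (E : set 'rV[R]_n.+2) (c : 'rV[R]_n.+2) :=
  [/\ segment_closed E, E `<=` piN n, E `<=` Phi @` (K `&` ecball x (3 / 4 * r)),
      piN n c & eball c (t * s) `&` piN n `<=` E].

Hypothesis biL : forall z1 z2, ecball x r z1 -> ecball x r z2 ->
  L^-1 * edist z1 z2 <= edist (Phi z1) (Phi z2) /\
  edist (Phi z1) (Phi z2) <= L * edist z1 z2.

(** The cone copy is shrunk by the homothety of ratio [t] centred at [Phi y], which fixes [Phi y]
    and turns the ball of radius [s] into one of radius [t * s]. *)
Lemma chart_core_exists y (D : set 'rV[R]_n.+1) :
  K y -> eball x (r / 2) y -> congruent C D -> (emb n @` D) (Phi y) ->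
  emb n @` D `<=` Phi @` (ecball x r `&` K) ->
  exists E c, chart_core E c /\ E (Phi y).
Proof.
move=> Ky yx [g [rg DE]] Dy DK.
have cD : segment_closed (emb n @` D).
  by rewrite DE; apply: emb_image_convex; apply: rigid_image_convex.
have Dpi : emb n @` D `<=` piN n by move=> _ [a _ <-]; exact: emb_max.
have Ddiam a b : (emb n @` D) a -> (emb n @` D) b -> edist a b <= rho + rho.
  rewrite DE => -[_ [a' Ca' <-] <-] [_ [b' Cb' <-] <-].
  rewrite emb_isometry rg; apply: (le_trans (edist_triangle 0 _ _)).
  by rewrite (edistC 0); apply: lerD; exact: Crho.
pose u := Phi y.
exists [set (1 - t) *: u + t *: q | q in emb n @` D], ((1 - t) *: u + t *: emb n (g c0)).
split; last first.
  by exists u => //; apply/rowP => i; rewrite !mxE; ring.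
split.
- move=> _ _ l [a Da <-] [b Db <-] l01.
  exists ((1 - l) *: a + l *: b); first exact: cD.
  by apply/rowP => i; rewrite !mxE; ring.
- by move=> _ [a Da <-]; apply: piN_convex => //; exact: Dpi.
- move=> _ [a Da <-].
  have Dw : (emb n @` D) ((1 - t) *: u + t *: a) by apply: cD.
  have [z [zx Kz] zE] := DK _ Dw.
  exists z => //; split => //.
  have yx' : ecball x r y by apply/ltW/(lt_trans yx); rewrite gtr_pMr// invf_lt1// ltr1n.
  have [+ _] := biL z y zx yx'; rewrite zE ler_pdivrMl// => zy.
  have wu : edist ((1 - t) *: u + t *: a) (Phi y) = t * edist a u.
    rewrite {1}/edist -/u (_ : _ - u = t *: (a - u)) ?enormZ ?gtr0_norm//.
    by apply/rowP => i; rewrite !mxE; ring.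
  rewrite wu in zy.
  have zy' : edist z y <= r / 4.
    by apply: (le_trans zy); apply: le_trans tL; rewrite !ler_pM2l// Ddiam.
  apply: (le_trans (edist_triangle y _ _)); rewrite /eball/= in yx; lra.
- by apply: piN_convex => //; [exact: Dpi|exact: emb_max].
- move=> w [wc piw].
  pose q := t^-1 *: (w - (1 - t) *: u).
  have wE : (1 - t) *: u + t *: q = w.
    by rewrite scalerA mulfV ?gt_eqF// scale1r addrC subrK.
  have piq : piN n q by rewrite /q /piN/= !mxE piw (Dpi _ Dy) mulr0 subrr mulr0.
  exists q => //; have [a aq] := emb_onto_piN _ piq; exists a => //.
  have ac : ecball (g c0) s a.
    rewrite /ecball/= -emb_isometry aq -(@ler_pM2l _ t)//.
    apply: ltW; apply: le_lt_trans wc; rewrite -{1}wE.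
    have -> : edist ((1 - t) *: u + t *: q) ((1 - t) *: u + t *: emb n (g c0)) =
        t * edist q (emb n (g c0)).
      rewrite -[X in X * _](gtr0_norm t0) -enormZ; congr enorm.
      by apply/rowP => i; rewrite !mxE; ring.
    by [].
  by rewrite DE; have [b bc <-] := rigid_image_ecball g rg c0 s _ ac; exists b => //; apply: sC.
Qed.

(** Half the radius of the balls in the cores: a core centred within [rho1] of [p] contains the ball
    of radius [rho1] around [p] in the hyperplane. *)
Let rho1 := t * s / 2.

Let rho10 : 0 < rho1. Proof. by rewrite divr_gt0// mulr_gt0. Qed.

Hypotheses (cK : compact K) (KO : K `<=` closure Omega) (Kx : K x) (Phix : Phi x = 0).
Hypothesis Phipi : Phi @` (K `&` eball x r) `<=` piN n.

Let r34 : 3 / 4 * r < r.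
Proof. by rewrite gtr_pMl// ltr_pdivrMr// mul1r ltr_nat. Qed.

Let K34 := K `&` ecball x (3 / 4 * r).

Let K34_r z : K34 z -> ecball x r z.
Proof. by move=> [_ zx]; apply: (le_trans zx); exact: ltW. Qed.

Let K34x : K34 x.
Proof. by split => //; rewrite /ecball/= edistxx mulr_ge0// ltW. Qed.

Let image_bound z : K34 z -> edist (Phi z) 0 <= L * r.
Proof.
move=> /K34_r zr; have [_] := biL z x zr (K34_r _ K34x).
by rewrite Phix => h; apply: (le_trans h); rewrite ler_pM2l.
Qed.

Let image_closed w :
  (forall d : R, 0 < d -> exists2 a, (Phi @` K34) a & edist a w < d) -> (Phi @` K34) w.
Proof.
apply: compact_edist_closed; apply: (compact_lipschitz_image _ _ L) => //; last first.
  by move=> a b Ka Kb; have [] := biL a b (K34_r _ Ka) (K34_r _ Kb).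
apply: (subclosed_compact _ cK); last by move=> z [].
move=> z /closure_eballP zK; split.
  by apply: compact_edist_closed => // d /zK[b [Kb _] bz]; exists b.
apply/ler_addgt0Pr => d /zK[b [_ bx] bz].
apply: (le_trans (edist_triangle b _ _)); rewrite edistC addrC.
by apply: lerD => //; exact: ltW.
Qed.

(** All cores with centre near [p] share a ball around [p], so the closure [U] of their union is
    star-shaped with respect to it. *)
Lemma chart_core_union_MR (p : 'rV[R]_n.+2) : (exists E, chart_core E p) ->
  exists H, [/\ classMR n Omega H (Num.min (r / 4) (rho1 / (4 * L)))
                  (L * (2 + 2 * (2 * L * r) / rho1)),
    H `<=` K & forall E c z, chart_core E c -> edist c p <= rho1 -> K34 z ->
      E (Phi z) -> H z].
Proof.
move=> [E0 E0p].
pose U := [set w | forall d : R, 0 < d -> exists E c a,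
  [/\ chart_core E c, edist c p <= rho1, E a & edist a w < d]].
have subU E c : chart_core E c -> edist c p <= rho1 -> E `<=` U.
  by move=> Ec cp a Ea d d0; exists E, c, a; rewrite edistxx.
have UK : U `<=` Phi @` K34.
  move=> w Uw; apply: image_closed => d /Uw[E [c [a [[_ _ EK _ _] _ Ea aw]]]].
  by exists a => //; exact: EK.
have pip : piN n p by have [] := E0p.
have pp : edist p p <= rho1 by rewrite edistxx ltW.
have E0p' : E0 p.
  have [_ _ _ _] := E0p; apply; split => //.
  by rewrite /eball/= edistxx mulr_gt0.
have Up : U p by exact: subU E0p pp _ E0p'.
have U_R0 : U `<=` ecball p (2 * L * r).
  move=> w Uw; apply: (le_trans (edist_triangle 0 _ _)).
  have [z zK <-] := UK _ Uw; have [z' z'K <-] := UK _ Up.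
  have -> : 2 * L * r = L * r + L * r by ring.
  by rewrite (edistC 0); apply: lerD; exact: image_bound.
have Upi : U `<=` piN n.
  move=> w /UK[z [Kz zx] <-]; apply: Phipi; exists z => //; split => //.
  exact: le_lt_trans zx _.
have Ucl w : (forall d : R, 0 < d -> exists2 a, U a & edist a w < d) -> U w.
  move=> Uw d d0; have d20 : 0 < d / 2 by rewrite divr_gt0.
  have [a Ua aw] := Uw _ d20; have [E [c [b [Ec cp Eb ba]]]] := Ua _ d20.
  exists E, c, b; split => //; apply: (le_lt_trans (edist_triangle a _ _)).
  by rewrite (splitr d) ltrD.
have Ustar a b (l : R) : U a -> piN n b -> eball p rho1 b -> 0 <= l <= 1 ->
    U ((1 - l) *: a + l *: b).
  (* Convexity gives the segment from a nearby core point [q] to [b]; its points stay within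
     [(1 - l) * edist q a] of those of the segment from [a]. *)
  move=> Ua pib bp l01 d d0; have [E [c [q [Ec cp Eq qa]]]] := Ua _ d0.
  have [cE _ _ _ Eball] := Ec.
  have Eb : E b.
    apply: Eball; split => //; apply: (le_lt_trans (edist_triangle p _ _)).
    by rewrite (splitr (t * s)) edistC (edistC p) edistC ltr_leD// edistC.
  exists E, c, ((1 - l) *: q + l *: b); split => //; first exact: cE.
  have -> : edist ((1 - l) *: q + l *: b) ((1 - l) *: a + l *: b) = (1 - l) * edist q a.
    have /andP[_ l1] := l01.
    rewrite -[X in X * _]ger0_norm ?subr_ge0// -enormZ; congr enorm.
    by apply/rowP => i; rewrite !mxE; ring.
  apply: le_lt_trans qa; rewrite ler_piMl ?edist_ge0//.
  by have /andP[l0 _] := l01; rewrite gerBl.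
exists [set z | [/\ K z, ecball x (3 / 4 * r) z & U (Phi z)]]; split.
- have LR0 : 0 < 2 * L * r by rewrite !mulr_gt0.
  have U0 : U !=set0 by exists p.
  exact: (starshaped_piece_MR U p rho1 _ rho10 LR0 pip Upi U_R0 Ucl Ustar
    Omega K Phi x r L r0 L0 cK KO biL U0 UK).
- by move=> z [].
- by move=> E c z Ec cp [Kz zx] Ez; split => //; exact: subU Ec cp _ Ez.
Qed.

(** Centres of cores lie within [L * r] of 0, so the net hypothesis sorts the cores into [M]
    clusters, each giving one piece. *)
Lemma local_pieces (M : nat) :
  (forall S : set 'rV[R]_n.+2, S !=set0 ->
     (forall a b, S a -> S b -> edist a b <= L * r + L * r) ->
     exists c : nat -> 'rV[R]_n.+2, (forall i, S (c i)) /\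
       forall a, S a -> exists2 i, (i < M)%N & edist a (c i) <= rho1) ->
  (forall y, K y -> eball x (r / 2) y ->
     exists D : set 'rV[R]_n.+1, congruent C D /\ (emb n @` D) (Phi y) /\
       emb n @` D `<=` Phi @` (ecball x r `&` K)) ->
  exists H : nat -> set 'rV[R]_n.+2,
    [/\ forall k, classMR n Omega (H k) (Num.min (r / 4) (rho1 / (4 * L)))
                    (L * (2 + 2 * (2 * L * r) / rho1)),
        forall k, H k `<=` K &
        forall y, K y -> eball x (r / 2) y -> exists2 k, (k < M)%N & H k y].
Proof.
move=> net cone.
have core y : K y -> eball x (r / 2) y -> exists E c, chart_core E c /\ E (Phi y).
  by move=> Ky yx; have [D [CD [Dy DK]]] := cone y Ky yx; exact: chart_core_exists CD Dy DK.
have center_bound E c : chart_core E c -> edist c 0 <= L * r.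
  move=> [_ _ EK pic Eball].
  have [|z zK <-] := EK c; last exact: image_bound.
  by apply: Eball; split => //; rewrite /eball/= edistxx mulr_gt0.
have [||c [cS cM]] := net [set c | exists E, chart_core E c].
- have [|E [c [Ec _]]] := core x Kx; last by exists c, E.
  by rewrite /eball/= edistxx divr_gt0.
- move=> a b [E Ea] [F Fb]; apply: (le_trans (edist_triangle 0 _ _)).
  by rewrite (edistC 0); apply: lerD; [exact: center_bound Ea|exact: center_bound Fb].
have /choice[H HP] := fun k => chart_core_union_MR _ (cS k).
exists H; split=> [k|k|y Ky yx]; [by have [] := HP k|by have [] := HP k|].
have [E [a [Ea Ey]]] := core y Ky yx.
have [k kM ak] := cM a (ex_intro _ E Ea).
have [_ _ HE] := HP k; exists k => //; apply: (HE E a) => //; split => //.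
apply: le_trans (ltW yx) _; rewrite -subr_ge0.
have -> : 3 / 4 * r - r / 2 = r / 4 by field.
by rewrite divr_ge0// ltW.
Qed.

End LocalPieces.

(** * Assembling the pieces *)

Lemma closure_diam {R : realType} {m} (A : set 'rV[R]_m) (D : R) :
  (forall a b, A a -> A b -> edist a b <= D) ->
  forall a b, closure A a -> closure A b -> edist a b <= D.
Proof.
move=> AD a b /closure_eballP Aa /closure_eballP Ab.
apply/ler_addgt0Pr => d d0; have d20 : 0 < d / 2 by rewrite divr_gt0.
have [a' Aa' aa'] := Aa _ d20; have [b' Ab' bb'] := Ab _ d20.
have := edist_triangle a' a b; have := edist_triangle b' a' b.
have := AD _ _ Aa' Ab'; rewrite (edistC a a'); lra.
Qed.

Lemma lip_charts_mono {R : realType} {n} (Omega K : set 'rV[R]_n.+2) (r r' L L' : R) Phi :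
  0 < L -> r' <= r -> L <= L' ->
  lip_charts n Omega K r L Phi -> lip_charts n Omega K r' L' Phi.
Proof.
move=> L0 rr LL [K0 [cK [KO charts]]]; split => //; split => //; split => // x Kx.
have [biL [Phix Phipi]] := charts x Kx; split; last first.
  split => // _ [z [Kz zx] <-]; apply: Phipi; exists z => //; split => //.
  exact: lt_le_trans zx rr.
move=> z1 z2 z1x z2x.
have [l u] := biL z1 z2 (le_trans z1x rr) (le_trans z2x rr); split.
  apply: le_trans l; rewrite ler_wpM2r ?edist_ge0// lef_pV2 ?posrE//.
  exact: lt_le_trans L0 LL.
by apply: (le_trans u); rewrite ler_wpM2r ?edist_ge0.
Qed.

Theorem theoremA8 (R : realType) (n : nat) (r L : R) (C : set 'rV[R]_(n.+1)) :
  0 < r -> 0 < L -> finite_closed_cone 0 C ->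
  exists r' L' : R, 0 < r' /\ 0 < L' /\
    forall D : R, exists M0 : nat,
      forall Omega : set 'rV[R]_(n.+2),
        open Omega -> ebounded Omega -> diam_eq Omega D ->
        forall K : set 'rV[R]_(n.+2),
          classG n Omega K r L C -> classFR n Omega K r' L' M0.
Proof.
move=> r0 L0 hC; have cC := finite_closed_cone0_convex C hC.
have [rho [c0 [s [rho0 s0 Crho sC]]]] := finite_closed_cone0_ecball C hC.
have t0 := shrink_factor_gt0 r L rho r0 L0 rho0.
pose rho1 := shrink_factor r L rho * s / 2.
have rho10 : 0 < rho1 by rewrite divr_gt0// mulr_gt0.
(* Both constants are fixed before [D]; the fraction is the graph slope for the outer radius
   [2 * L * r]. *)
exists (Num.min (r / 4) (rho1 / (4 * L))), (L * (2 + 2 * (2 * L * r) / rho1)).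
set r' := Num.min _ _; set L' := L * _.
have q0 : 0 < 2 * (2 * L * r) / rho1 by rewrite divr_gt0 ?mulr_gt0.
have LL' : L <= L' by rewrite ler_peMr// ?ltW//; lra.
split; first by rewrite lt_min !divr_gt0 ?mulr_gt0.
split; first exact: lt_le_trans LL'.
move=> D.
have r40 : 0 < r / 4 by rewrite divr_gt0.
(* [M1] counts base points in [K], with mesh [r / 4] so that the balls of radius [r / 2] cover; [M2]
   counts clusters in one chart. Only [M1] depends on [D]. *)
have [M1 net1] := uniform_finite_net R n.+2 D (r / 4) r40.
have [M2 net2] := uniform_finite_net R n.+2 (L * r + L * r) rho1 rho10.
exists (M1 * M2)%N => Omega _ _ [diamD _] K [Phi [lip cone]].
have [K0 [cK [KO charts]]] := lip.
have r'r : r' <= r.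
  by rewrite ge_min; apply/orP; left; rewrite ler_pdivrMr// ler_peMr ?(ltW r0)// ler1n.
split; first by exists Phi; exact: lip_charts_mono lip.
have Kdiam a b : K a -> K b -> edist a b <= D.
  by move=> /KO Oa /KO Ob; exact: closure_diam diamD _ _ Oa Ob.
have [x [Kx xM]] := net1 K K0 Kdiam.
have /choice[H HP] : forall i, exists H : nat -> set 'rV[R]_n.+2,
    [/\ forall k, classMR n Omega (H k) r' L', forall k, H k `<=` K &
        forall y, K y -> eball (x i) (r / 2) y -> exists2 k, (k < M2)%N & H k y].
  move=> i; have [biL [Phix Phipi]] := charts _ (Kx i).
  apply: (local_pieces r L rho s C c0 r0 L0 rho0 s0 cC Crho sC Omega K (Phi (x i)) (x i)) => //.
  by move=> y Ky yx; exact: cone.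
have cover y : K y -> exists i k, [/\ (i < M1)%N, (k < M2)%N & H i k y].
  move=> Ky; have [i iM yx] := xM y Ky; have [_ _ Hc] := HP i.
  have [|k kM Hy] := Hc y Ky; last by exists i, k.
  apply: (le_lt_trans yx); lra.
(* A point of [K] forces both counts to be positive, as [1 <= J] demands. *)
have [y0 Ky0] := K0; have [i0 [k0 [i0M k0M _]]] := cover y0 Ky0.
(* The index [j] encodes a base point and a cluster as quotient and remainder by [M2]. *)
exists (M1 * M2)%N, (fun j => H (j %/ M2)%N (j %% M2)%N); split.
  by rewrite leqnn andbT muln_gt0 (leq_ltn_trans _ i0M)// (leq_ltn_trans _ k0M).
split; last by move=> j _; have [] := HP (j %/ M2)%N.
apply/seteqP; split => [y Ky|y [j _ Hy]]; last first.
  by have [_ HK _] := HP (j %/ M2)%N; exact: HK Hy.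
have [i [k [iM kM Hy]]] := cover y Ky.
have M20 : (0 < M2)%N by exact: leq_ltn_trans kM.
exists (i * M2 + k)%N => /=; last by rewrite divnMDl// divn_small// addn0 modnMDl modn_small.
by rewrite (@leq_trans (i.+1 * M2))// ?leq_mul2r ?iM ?orbT// mulSn addnC ltn_add2r.
Qed.
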